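(* Let $q$ be a prime power, $n\ge 2$, and let $\Sigma=\{\langle (x,x^{q},\ldots,x^{q^{n-1}})\rangle_{\mathbb{F}_{q^n}} : x\in\mathbb{F}_{q^n}^*\}$ in $\mathrm{PG}(n-1,q^n)$. Let $\sigma$ be a collineation of $\mathrm{PG}(n-1,q^n)$ whose set of fixed points is exactly $\Sigma$. Let $\Gamma$ be a projective subspace of $\mathrm{PG}(n-1,q^n)$ of dimension $k$ with $\Gamma\cap\Sigma=\emptyset$. If $\dim(\Gamma\cap\Gamma^{\sigma})=k-1$, then there exists exactly one point $P$ of $\mathrm{PG}(n-1,q^n)$ such that \[\Gamma=\langle P,P^{\sigma},\ldots,P^{\sigma^{k}}\rangle .\] Furthermore, $P^{\sigma^{n-1}}\notin\Gamma$.
   Context: $\mathrm{PG}(n-1,q^n)$ has homogeneous coordinates $x_0,\ldots,x_{n-1}$; $\Sigma\cong\mathrm{PG}(n-1,q)$ is a canonical subgeometry. The collineations with fixed point set exactly $\Sigma$ are the powers $\hat\sigma^s$ with $\gcd(s,n)=1$ of the collineation $\hat\sigma:\langle(x_0,\ldots,x_{n-1})\rangle_{\mathbb{F}_{q^n}}\mapsto\langle(x_{n-1}^q,x_0^q,\ldots,x_{n-2}^q)\rangle_{\mathbb{F}_{q^n}}$. Dimensions are projective dimensions, the empty subspace has dimension $-1$, angle brackets without a field denote projective span, and $S^{\sigma}$ is the image of $S$ under $\sigma$. *)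

(* Defs.v *)
From HB Require Import structures.
From mathcomp Require Import all_boot all_order all_algebra.

Set Implicit Arguments.
Unset Strict Implicit.
Unset Printing Implicit Defensive.

Import GRing.Theory.
Local Open Scope ring_scope.

Definition prime_power (q : nat) : Prop :=
  exists p e : nat, [/\ prime p, (0 < e)%N & q = (p ^ e)%N].

(* A projective subspace of PG(n-1, F) is represented by the vector subspace
   of F^n underlying it; a point is a vector subspace of dimension one. *)
Notation pg_subspace F n := {vspace 'rV[F]_n}.

(* Projective dimension, an int so that the empty subspace has dimension -1. *)
Definition pdim (F : fieldType) (n : nat) (U : pg_subspace F n) : int :=
  (\dim U)%:Z - 1.

Definition is_point (F : fieldType) (n : nat) (P : pg_subspace F n) : Prop :=
  pdim P = 0.

(* Collineations are the elements of PGammaL(n, F), acting on all subspaces: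
   phi U is the image of U under a bijective theta-semilinear map f.  (For
   n = 2 preservation of lines would be no condition at all.)  Over a finite
   field a ring endomorphism theta is automatically an automorphism. *)
Definition is_collineation (F : finFieldType) (n : nat)
    (phi : pg_subspace F n -> pg_subspace F n) : Prop :=
  exists (theta : {rmorphism F -> F})
         (f : {linear 'rV[F]_n -> 'rV[F]_n | theta \; *:%R}),
    bijective f /\
    forall (U : pg_subspace F n) (v : 'rV[F]_n), (f v \in phi U) = (v \in U).

Definition in_Sigma (F : finFieldType) (q n : nat) (P : pg_subspace F n) :
    Prop :=
  exists2 x : F, x != 0 & P = <[\row_(i < n) x ^+ (q ^ i)]>%VS.

Definition orbit_span (F : finFieldType) (n : nat)
    (phi : pg_subspace F n -> pg_subspace F n) (P : pg_subspace F n)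
    (k : nat) : pg_subspace F n :=
  (\sum_(i < k.+1) iter i phi P)%VS.

(* Main.v *)
Require Import Defs.
From HB Require Import structures.
From mathcomp Require Import all_boot all_order all_algebra.
From mathcomp Require Import cyclic finfield.
From mathcomp Require Import zify.

Set Implicit Arguments.
Unset Strict Implicit.
Unset Printing Implicit Defensive.

Import GRing.Theory.
Local Open Scope ring_scope.

(* Fixing every point of Sigma forces the semilinear map f underlying sigma to
   act, in a basis of Moore rows (x, x^q, ..., x^(q^(n-1))), as a scalar times
   an entrywise field automorphism fixing F_q.  Hence sigma^n = 1, and a nonzero
   sigma-stable subspace meets Sigma.  So Gamma has no nonzero stable subspace,
   and in the chain Gamma, Gamma cap Gamma^sigma, ... each step lowers the
   dimension by exactly one; its last nonzero term is the point P^(sigma^k),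
   which yields existence and uniqueness of P.  If P^(sigma^(n-1)) were in
   Gamma, then P would be in Gamma^sigma, so that Gamma^sigma = Gamma. *)

(** * Lattice argument for an abstract dimension-preserving [sigma] *)

Section OrbitSpan.

Variables (F : finFieldType) (n : nat).
Variable sigma : pg_subspace F n -> pg_subspace F n.
Hypothesis sigma_mono : forall U V, (sigma U <= sigma V)%VS = (U <= V)%VS.
Hypothesis sigma_dim : forall U, \dim (sigma U) = \dim U.
Hypothesis sigma_add : forall U V, sigma (U + V)%VS = (sigma U + sigma V)%VS.

Lemma sigma_inj : injective sigma.
Proof.
move=> U V eqUV; apply/eqP; rewrite eqEsubv -sigma_mono eqUV subvv /=.
by rewrite -sigma_mono eqUV.
Qed.

Lemma iter_mono i U V : (iter i sigma U <= iter i sigma V)%VS = (U <= V)%VS.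
Proof. by elim: i => //= i IHi; rewrite sigma_mono. Qed.

Lemma iter_dim i U : \dim (iter i sigma U) = \dim U.
Proof. by elim: i => //= i IHi; rewrite sigma_dim. Qed.

Lemma iter_inj i : injective (iter i sigma).
Proof. by elim: i => //= i IHi U V /sigma_inj /IHi. Qed.

Lemma sigma_fix U : (sigma U <= U)%VS -> sigma U = U.
Proof. by move=> sU; apply/eqP; rewrite eqEdim sU sigma_dim leqnn. Qed.

Lemma orbit_spanS P j :
  orbit_span sigma P j.+1 = (orbit_span sigma P j + iter j.+1 sigma P)%VS.
Proof. by rewrite /orbit_span big_ord_recr. Qed.

Lemma iter_sub_orbit_span P j k :
  (j <= k)%N -> (iter j sigma P <= orbit_span sigma P k)%VS.
Proof. by rewrite -ltnS => lejk; apply: (sumv_sup (Ordinal lejk)). Qed.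

Lemma orbit_span_sub P k U :
  (forall j, (j <= k)%N -> (iter j sigma P <= U)%VS) ->
  (orbit_span sigma P k <= U)%VS.
Proof. by move=> sPU; apply/subv_sumP=> i _; apply: sPU; rewrite -ltnS. Qed.

Lemma sigma_orbit_span P k :
  (sigma (orbit_span sigma P k) <= orbit_span sigma P k.+1)%VS.
Proof.
elim: k => [|k IHk].
  by rewrite {1}/orbit_span big_ord1 (@iter_sub_orbit_span P 1).
rewrite (orbit_spanS P k) sigma_add (orbit_spanS P k.+1).
exact: addvS.
Qed.

Variable Gamma : pg_subspace F n.
Hypothesis Gamma_free : forall U, (U <= Gamma)%VS -> sigma U = U -> U = 0%VS.

(** If a further iterate failed to raise the dimension, the span reached so far would contain its
    own image, hence be stable, hence be zero by [Gamma_free]. *)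
Lemma dim_orbit_span P k :
    \dim P = 1%N -> (orbit_span sigma P k <= Gamma)%VS ->
  \dim (orbit_span sigma P k) = k.+1.
Proof.
move=> dimP; elim: k => [|k IHk] sSG; first by rewrite /orbit_span big_ord1.
have sS : (orbit_span sigma P k <= orbit_span sigma P k.+1)%VS.
  by rewrite orbit_spanS addvSl.
have dimS := IHk (subv_trans sS sSG).
have le_dim : (\dim (orbit_span sigma P k.+1) <= k.+2)%N.
  rewrite orbit_spanS.
  have := dimv_sum_cap (orbit_span sigma P k) (iter k.+1 sigma P).
  rewrite dimS iter_dim dimP; lia.
apply/eqP; rewrite eqn_leq le_dim ltnNge; apply/negP=> ge_dim.
have /eqP eqS : orbit_span sigma P k == orbit_span sigma P k.+1.
  by rewrite eqEdim sS dimS.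
have := Gamma_free (subv_trans sS sSG).
rewrite sigma_fix => [/(_ erefl) S0|]; first by rewrite S0 dimv0 in dimS.
by rewrite {2}eqS sigma_orbit_span.
Qed.

(** This is the intersection of the images of [Gamma] under the first powers of [sigma], from 0 to
    [i]. Written recursively, each term is the meet of the previous one with its own image, ready
    for the dimension formula. *)
Let cap i : pg_subspace F n := iter i (fun U => U :&: sigma U)%VS Gamma.

Let cap_sub i : (cap i <= Gamma)%VS.
Proof. by elim: i => //= i; apply: subv_trans; apply: capvSl. Qed.

Let cap_sub_iter i j : (j <= i)%N -> (cap i <= iter j sigma Gamma)%VS.
Proof.
elim: i j => [|i IHi] [|j] //= leji.
  exact: (cap_sub i.+1).
by apply: subv_trans (capvSr _ _) _; rewrite sigma_mono; apply: IHi.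
Qed.

Let orbit_sub_cap P k i j :
    (orbit_span sigma P k <= Gamma)%VS -> (i <= j <= k)%N ->
  (iter j sigma P <= cap i)%VS.
Proof.
move=> sSG; elim: i j => [|i IHi] [|j] //= leij.
- by apply: subv_trans sSG; apply: (@iter_sub_orbit_span _ 0%N).
- by apply: subv_trans sSG; apply: (@iter_sub_orbit_span _ j.+1).
by rewrite subv_cap sigma_mono (IHi j.+1) ?IHi //; lia.
Qed.

Variable k : nat.
Hypothesis dim_Gamma : \dim Gamma = k.+1.
Hypothesis dim_Gamma_cap : \dim (Gamma :&: sigma Gamma) = k.

(** Two consecutive dimensions are carried so that the induction knows the last drop. Both
    [cap i.+1] and its image lie in [sigma (cap i)], so the next drop is at most the last one,
    namely 1. It is not 0, since [cap i.+1] would then be stable, hence zero. *)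
Let dim_cap i :
    (i <= k)%N ->
  \dim (cap i) = (k.+1 - i)%N /\ \dim (cap i.+1) = (k - i)%N.
Proof.
elim: i => [|i IHi] lik; first by rewrite !subn0.
have [dimi dimSi] := IHi (ltnW lik); split; first by rewrite dimSi.
have lb : (\dim (cap i.+1 + sigma (cap i.+1)) <= \dim (cap i))%N.
  rewrite -(sigma_dim (cap i)) dimvS // subv_add /= capvSr sigma_mono.
  exact: capvSl.
have ub : (\dim (cap i.+2) <= \dim (cap i.+1))%N by rewrite dimvS ?capvSl.
have := dimv_sum_cap (cap i.+1) (sigma (cap i.+1)); rewrite sigma_dim.
suff: \dim (cap i.+2) != \dim (cap i.+1).
  by move: lb ub lik; rewrite dimi dimSi /= -/(cap i) -/(cap i.+1); lia.
apply/eqP=> eq_dim.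
have /eqP eq_cap : cap i.+2 == cap i.+1 by rewrite eqEdim capvSl eq_dim /=.
have fix_cap : sigma (cap i.+1) = cap i.+1.
  by apply/eqP; rewrite eq_sym eqEdim -{1}eq_cap capvSr sigma_dim /=.
have c0 := Gamma_free (cap_sub i.+1) fix_cap.
by rewrite c0 dimv0 in dimSi; lia.
Qed.

(** The last iterate of a generating point lies in every image of [Gamma] used in [cap k], which is
    itself a point; so it equals [cap k]. *)
Lemma orbit_span_uniq P Q :
    \dim P = 1%N -> \dim Q = 1%N ->
    Gamma = orbit_span sigma P k -> Gamma = orbit_span sigma Q k ->
  P = Q.
Proof.
have [dim_k _] := dim_cap (leqnn k).
suff eq_cap R : \dim R = 1%N -> Gamma = orbit_span sigma R k ->
    iter k sigma R = cap k.
  by move=> dP dQ gP gQ; apply: (@iter_inj k); rewrite !eq_cap.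
move=> dR gR; apply/eqP; rewrite eqEdim (@orbit_sub_cap _ k) ?leqnn //.
  by rewrite iter_dim dR dim_k; lia.
by rewrite -gR.
Qed.

Hypothesis n_gt0 : (0 < n)%N.
Hypothesis sigma_order : forall U, iter n sigma U = U.

Lemma orbit_span_exists :
  exists P, \dim P = 1%N /\ Gamma = orbit_span sigma P k.
Proof.
have [dim_k _] := dim_cap (leqnn k).
have iterK j U : iter (j * n) sigma U = U.
  by elim: j => // j IHj; rewrite mulSn iterD IHj.
(* The inverse of [sigma ^ k], written as a nonnegative power because [sigma ^ n] is the identity;
   [k <= k * n] makes the subtraction exact. *)
pose P := iter (k * n - k) sigma (cap k).
have iterP : iter k sigma P = cap k.
  by rewrite -iterD subnKC ?iterK //; nia.
have dimP : \dim P = 1%N by rewrite iter_dim dim_k; lia.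
exists P; split=> //; apply/eqP.
have sSG : (orbit_span sigma P k <= Gamma)%VS.
  apply: orbit_span_sub => j lejk.
  rewrite -(iter_mono (k - j)) -iterD subnK // iterP.
  by apply: cap_sub_iter; lia.
by rewrite eq_sym eqEdim sSG (dim_orbit_span dimP sSG) dim_Gamma leqnn.
Qed.

Lemma orbit_span_last P :
  Gamma = orbit_span sigma P k -> ~ (iter n.-1 sigma P <= Gamma)%VS.
Proof.
move=> gP sPG.
have sGG : (Gamma <= sigma Gamma)%VS.
  (* Only [P] itself needs the assumption, being the image of its iterate [n.-1]; every other
     generator is the image of the preceding one. *)
  rewrite {1}gP; apply: orbit_span_sub => -[|j] lejk /=.
    have <- : iter n.-1.+1 sigma P = P by rewrite prednK.
    by rewrite /= sigma_mono.
  by rewrite sigma_mono gP iter_sub_orbit_span // ltnW.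
have := dim_Gamma_cap; rewrite (capv_idPl sGG) dim_Gamma; lia.
Qed.

End OrbitSpan.

(** * Finite fields: Frobenius powers and field automorphisms *)

Lemma frobenius_iter (F : finFieldType) (p e : nat) :
    p \in [pchar F] ->
  exists phi : {rmorphism F -> F}, forall x, phi x = x ^+ (p ^ e).
Proof.
move=> pF; elim: e => [|e [phi phiE]]; first by exists idfun => x; rewrite expr1.
exists (pFrobenius_aut pF \o phi) => x /=.
by rewrite phiE pFrobenius_autE -exprM expnSr.
Qed.

Lemma finField_generator (F : finFieldType) :
  exists z : F, forall x, x != 0 -> exists i, x = z ^+ i.
Proof.
have F_gt1 : (0 < #|F|.-1)%N by rewrite -subn1 subn_gt0 finNzRing_gt1.
have unityP (x : F) : x != 0 -> x ^+ #|F|.-1 = 1.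
  move=> nz_x; apply: (mulfI nz_x); rewrite -exprS prednK ?expf_card ?mulr1 //.
  exact: ltnW (finNzRing_gt1 F).
have /hasP[z _ prim_z] : has (#|F|.-1).-primitive_root (enum (predC1 (0 : F))).
  apply: has_prim_root => //; last by rewrite -cardE cardC1.
    by apply/allP=> x; rewrite mem_enum => /unityP eq1; apply/unity_rootP.
  exact: enum_uniq.
exists z => x /unityP /(prim_rootP prim_z)[i ->].
by exists i.
Qed.

Section Galois.

Variables (F : finFieldType) (q n : nat).
Hypothesis q_prime_power : prime_power q.
Hypothesis card_F : #|F| = (q ^ n)%N.

Lemma q_gt1 : (1 < q)%N.
Proof.
have [p [e [pr_p e_gt0 ->]]] := q_prime_power.
by rewrite -(exp1n e) ltn_exp2r ?prime_gt1.
Qed.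

Lemma frobenius_q :
  exists phi : {rmorphism F -> F}, forall x, phi x = x ^+ q.
Proof.
have [p [e [pr_p e_gt0 def_q]]] := q_prime_power; rewrite def_q.
apply/frobenius_iter/(@card_finPcharP _ _ (e * n)%N) => //.
by rewrite card_F def_q expnM.
Qed.

Lemma exprqD i (x y : F) : (x + y) ^+ (q ^ i) = x ^+ (q ^ i) + y ^+ (q ^ i).
Proof.
have [phi phiE] := frobenius_q.
elim: i => [|i IHi]; first by rewrite !expr1.
by rewrite expnSr !exprM IHi -!phiE rmorphD.
Qed.

(* The product of the X - x^(q^i) is a polynomial over F_q, so theta permutes
   its roots; apply this to a generator of the multiplicative group. *)
Lemma aut_order (theta : {rmorphism F -> F}) (x : F) :
  (forall a, a ^+ q = a -> theta a = a) -> iter n theta x = x.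
Proof.
move=> theta_fix; have [phi phiE] := frobenius_q.
have n_gt0 : (0 < n)%N.
  by case: (n) card_F (finNzRing_gt1 F) => // ->.
have [z genz] := finField_generator F.
pose p := \prod_(i < n) ('X - (z ^+ (q ^ i))%:P).
(* Frobenius shifts the factors cyclically; the cycle closes because [z ^+ (q ^ n) = z]. *)
have phip : map_poly phi p = p.
  rewrite /p; case: (n) n_gt0 card_F => // m _ cardF; rewrite rmorph_prod.
  rewrite big_ord_recr big_ord_recl mulrC /=; congr (_ * _).
    by apply: eq_bigr => i _; rewrite map_polyXsubC phiE -exprM -expnSr.
  by rewrite map_polyXsubC phiE -exprM -expnSr -cardF expf_card expr1.
have thetap : map_poly theta p = p.
  apply/polyP=> i; rewrite coef_map; apply: theta_fix.
  by rewrite -phiE -[in RHS]phip [RHS]coef_map.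
have rootz : root p z.
  rewrite /p (bigD1 (Ordinal n_gt0)) //= rootM root_XsubC expr1 eqxx //.
have [s thetaz] : exists s, theta z = z ^+ (q ^ s).
  have := rmorph_root theta rootz; rewrite thetap /p /root horner_prod.
  rewrite prodf_seq_eq0 => /hasP[s _ /=]; rewrite hornerXsubC subr_eq0 => /eqP.
  by exists s.
have theta_pow y : theta y = y ^+ (q ^ s).
  have [->|/genz[i ->]] := eqVneq y 0.
    by rewrite rmorph0 expr0n -leqn0 leqNgt expn_gt0 (ltnW q_gt1).
  by rewrite rmorphXn thetaz /= -!exprM mulnC.
have iter_theta i : iter i theta x = x ^+ ((q ^ i) ^ s).
  elim: i => [|i IHi]; first by rewrite exp1n expr1.
  by rewrite iterS IHi theta_pow -exprM -expnMn -expnSr.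
(* For [i = n] the exponent is a power of [#|F|], and raising to [#|F|] is the identity. *)
rewrite iter_theta -card_F; elim: (s) => [|j IHj]; first by rewrite expr1.
by rewrite expnS exprM expf_card IHj.
Qed.

(** * Moore rows, the vectors spanning the points of Sigma *)

Definition moore_row (x : F) : 'rV[F]_n := \row_(i < n) x ^+ (q ^ i).

Lemma moore_rowD x y : moore_row (x + y) = moore_row x + moore_row y.
Proof. by apply/rowP=> i; rewrite !mxE exprqD. Qed.

Lemma moore_rowZ a x : a ^+ q = a -> moore_row (a * x) = a *: moore_row x.
Proof.
move=> aq; apply/rowP=> i; rewrite !mxE exprMn; congr (_ * _).
by elim: (i : nat) => [|j IHj]; rewrite ?expr1 // expnSr exprM IHj.
Qed.

(* A linear form vanishing on all Moore rows is a polynomial of degree less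
   than q^n with q^n roots. *)
Lemma moore_basis :
  exists x : 'I_n -> F, \matrix_(i < n) moore_row (x i) \in unitmx.
Proof.
pose M := \matrix_(i < #|F|) moore_row (enum_val i).
suff fullM : row_full M.
  exists (enum_val \o fullrankfun fullM).
  have := fullrowsub_unit fullM; congr (is_true (_ \in unitmx)).
  by apply/matrixP=> i j; rewrite !mxE.
rewrite -cokermx_eq0; apply/eqP/matrixP=> i j.
set C := cokermx M.
pose p : {poly F} := \sum_(l < n) C l j *: 'X^(q ^ l).
have q1 := q_gt1.
(* The exponents [q ^ l] are distinct as [q > 1], so the column of the cokernel can be read off
   [p]. *)
have p_coef (l : 'I_n) : p`_(q ^ l) = C l j.
  rewrite coef_sum (bigD1 l) //= coefZ coefXn eqxx mulr1 big1 ?addr0 // => m neq.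
  rewrite coefZ coefXn; case: eqP => [/(expnI q1)/val_inj eq_lm|].
    by rewrite eq_lm eqxx in neq.
  by rewrite mulr0.
suff p0 : p = 0 by rewrite -p_coef p0 coef0 mxE.
apply/eqP; apply: contraT => nz_p.
have all_roots : all (root p) (enum F).
  apply/allP=> x _; apply/eqP.
  have := congr1 (fun A : 'M_(_, _) => A (enum_rank x) j) (mulmx_coker M).
  rewrite [RHS]mxE => <-; rewrite mxE horner_sum; apply: eq_bigr => l _.
  by rewrite hornerZ hornerXn !mxE enum_rankK mulrC.
have := max_poly_roots nz_p all_roots (enum_uniq _).
rewrite -cardE card_F ltnNge (leq_trans (size_sum _ _ _)) //.
apply/bigmax_leqP=> l _; apply: leq_trans (size_scale_leq _ _) _.
by rewrite size_polyXn ltn_exp2l.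
Qed.

End Galois.

(** * Collineations with fixed point set Sigma *)

Section Collineation.

Variables (F : finFieldType) (n : nat).
Variable sigma : pg_subspace F n -> pg_subspace F n.
Variables (theta : {rmorphism F -> F})
          (f : {linear 'rV[F]_n -> 'rV[F]_n | theta \; *:%R}).
Hypothesis f_bij : bijective f.
Hypothesis mem_sigma : forall U v, (f v \in sigma U) = (v \in U).

Lemma collineation_mono U V : (sigma U <= sigma V)%VS = (U <= V)%VS.
Proof.
have [g fK gK] := f_bij; apply/subvP/subvP => sUV v vU.
  by rewrite -mem_sigma sUV ?mem_sigma.
by move: vU; rewrite -(gK v) !mem_sigma; apply: sUV.
Qed.

(** As [f] is only semilinear, dimensions are compared by counting: [f] maps [U] bijectively onto
    [sigma U]. *)
Lemma collineation_dim U : \dim (sigma U) = \dim U.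
Proof.
have [g fK gK] := f_bij.
apply: (expnI (finNzRing_gt1 F)); rewrite -!card_vspace.
rewrite -(card_image (bij_inj f_bij) U); apply: eq_card => v.
by rewrite -[v in LHS]gK mem_sigma -[v in RHS]gK mem_image //; apply: bij_inj.
Qed.

Lemma collineation_add U V : sigma (U + V)%VS = (sigma U + sigma V)%VS.
Proof.
have [g fK gK] := f_bij.
apply: subv_anti; rewrite subv_add !collineation_mono addvSl addvSr !andbT.
apply/subvP=> v; rewrite -(gK v) mem_sigma => /memv_addP[u uU [w wV ->]].
by rewrite linearD memv_add ?mem_sigma.
Qed.

Lemma collineation_iter i U v :
  (iter i f v \in iter i sigma U) = (v \in U).
Proof. by elim: i => //= i IHi; rewrite mem_sigma. Qed.

Lemma collineationZ a v : f (a *: v) = theta a *: f v.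
Proof. exact: linearZ_LR. Qed.

Variable q : nat.
Hypothesis q_prime_power : prime_power q.
Hypothesis n_ge2 : (2 <= n)%N.
Hypothesis card_F : #|F| = (q ^ n)%N.
Hypothesis sigma_Sigma :
  forall P : pg_subspace F n, is_point P -> (sigma P = P <-> in_Sigma q P).

Lemma is_point_line (v : 'rV[F]_n) : v != 0 -> is_point <[v]>%VS.
Proof. by move=> nz_v; rewrite /is_point /pdim dim_vline nz_v subrr. Qed.

Lemma collineation_moore_row x : moore_row q n x != 0 ->
  exists c, f (moore_row q n x) = c *: moore_row q n x.
Proof.
move=> nz_v; have nz_x : x != 0.
  apply: contraNneq nz_v => ->; apply/eqP/rowP=> i; rewrite !mxE expr0n.
  by have := expn_gt0 q i; rewrite (ltnW (q_gt1 q_prime_power)) lt0n => /negPf->.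
have /(sigma_Sigma (is_point_line nz_v)) fixP :
  in_Sigma q <[moore_row q n x]>%VS by exists x.
by apply/vlineP; rewrite -fixP mem_sigma memv_line.
Qed.

(* Comparing f on a point of Sigma spanned by a sum of two basis vectors
   shows that all basis vectors are scaled by the same factor. *)
Lemma collineation_normal_form :
  exists (c : F) (B : 'M[F]_n),
    [/\ c != 0, B \in unitmx, forall a, a ^+ q = a -> theta a = a &
        forall w, f (w *m B) = c *: (map_mx theta w *m B)].
Proof.
have [x unitB] := moore_basis q_prime_power card_F.
set B := (\matrix_(i < n) _) in unitB.
have rowB i : row i B = moore_row q n (x i) by rewrite rowK.
have injB : injective (mulmx^~ B : 'rV_n -> 'rV_n).
  by apply: row_free_inj; rewrite row_free_unit.
have nz_row i : row i B != 0.
  rewrite rowE -(mul0mx _ B) (inj_eq injB); apply/eqP=> /rowP/(_ i)/eqP.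
  by rewrite !mxE !eqxx oner_eq0.
have free2 i j a b a' b' : i != j ->
    a *: row i B + b *: row j B = a' *: row i B + b' *: row j B ->
  a = a' /\ b = b'.
  move=> neq_ij; rewrite !rowE !scalemxAl -!mulmxDl => /injB/rowP eqv.
  have := eqv i; have := eqv j; rewrite !mxE !eqxx eq_sym (negPf neq_ij) /=.
  by rewrite !mulr0 !mulr1 !add0r !addr0.
have /fin_all_exists[c fc] i : exists c, f (row i B) = c *: row i B.
  by have := nz_row i; rewrite rowB; apply: collineation_moore_row.
(* The case [a = 1] will equate all the factors; a general [a] then shows that [theta] fixes F_q.
   Two distinct indices exist since [n >= 2]. *)
have two_rows i j a : i != j -> a ^+ q = a -> c i * a = theta a * c j.
  move=> neq_ij aq.
  have sum_moore : row i B + a *: row j B = moore_row q n (x i + a * x j).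
    by rewrite !rowB (moore_rowD q_prime_power card_F) moore_rowZ.
  have nz_sum : row i B + a *: row j B != 0.
    apply/eqP=> sum0; have [] := @free2 i j 1 a 0 0 neq_ij.
      by rewrite scale1r sum0 !scale0r addr0.
    by move/eqP; rewrite oner_eq0.
  have [d] : exists d,
      f (row i B + a *: row j B) = d *: (row i B + a *: row j B).
    by move: nz_sum; rewrite sum_moore; apply: collineation_moore_row.
  rewrite linearD collineationZ !fc scalerDr !scalerA.
  by case/(free2 i j _ _ _ _ neq_ij)=> -> ->.
pose i0 : 'I_n := Ordinal (ltnW n_ge2); pose i1 : 'I_n := Ordinal n_ge2.
have c_const i : c i = c i0.
  have [->//|neq] := eqVneq i i0.
  by have := @two_rows i i0 1 neq (expr1n _ _); rewrite rmorph1 mulr1 mul1r.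
have nz_c : c i0 != 0.
  apply: contraNneq (nz_row i0) => c0; apply/eqP/(bij_inj f_bij).
  by rewrite fc c0 scale0r linear0.
exists (c i0), B; split=> // [a aq|w].
  have := @two_rows i0 i1 a isT aq; rewrite (c_const i1) mulrC.
  by move/(mulIf nz_c).
rewrite !mulmx_sum_row linear_sum scaler_sumr; apply: eq_bigr => i _.
by rewrite collineationZ fc c_const !scalerA mxE mulrC.
Qed.

(** In the basis [B], the power [f ^ n] is a nonzero scalar times the entrywise [theta ^ n], which
    is the identity by [aut_order]; subspaces do not see the scalar. *)
Lemma collineation_order U : iter n sigma U = U.
Proof.
have [c [B [nz_c unitB theta_fix fE]]] := collineation_normal_form.
have iter_f i w : exists2 d, d != 0 &
    iter i f (w *m B) = d *: (map_mx (iter i theta) w *m B).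
  elim: i => [|i [d nz_d IHi]].
    by exists 1; rewrite ?oner_eq0 // scale1r /= map_mx_id.
  exists (theta d * c); first by rewrite mulf_neq0 ?fmorph_eq0.
  by rewrite iterS IHi collineationZ fE scalerA -map_mx_comp.
apply/vspaceP=> v; rewrite -(collineation_iter n U v).
rewrite -[v](mulmxKV unitB); case: (iter_f n (v *m invmx B)) => d nz_d ->.
rewrite rpredZeq (negPf nz_d) /=.
suff -> : map_mx (iter n theta) (v *m invmx B) = v *m invmx B by [].
by apply/rowP=> i; rewrite mxE (aut_order q_prime_power card_F).
Qed.

(* A nonzero vector of least weight in a stable subspace, scaled to have a
   coordinate 1, is fixed: otherwise subtracting its image lowers the weight. *)
Lemma collineation_stable U : U != 0%VS -> sigma U = U ->
  exists P, [/\ is_point P, in_Sigma q P & (P <= U)%VS].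
Proof.
move=> nz_U fixU.
have [c [B [nz_c unitB theta_fix fE]]] := collineation_normal_form.
pose wt (w : 'rV[F]_n) := #|[pred i | w 0 i != 0]|.
pose inU := [pred w : 'rV[F]_n | (w != 0) && (w *m B \in U)].
have inU0 : inU (vpick U *m invmx B).
  rewrite /= mulmxKV // memv_pick andbT; apply: contraNneq nz_U => w0.
  by rewrite -vpick0 -[vpick U](mulmxKV unitB) w0 mul0mx.
have [w /andP[nz_w wU] min_w] := arg_minnP wt inU0.
have /rV0Pn[i nz_wi] := nz_w.
pose u := (w 0 i)^-1 *: w.
have uU : u *m B \in U by rewrite -scalemxAl memvZ.
have ui : u 0 i = 1 by rewrite mxE mulVf.
have fix_u : map_mx theta u = u.
  apply/eqP; rewrite -subr_eq0; apply: contraT => nz_d.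
  have : inU (map_mx theta u - u).
    rewrite /= nz_d mulmxBl rpredB //.
    have : f (u *m B) \in U by rewrite -fixU mem_sigma.
    by rewrite fE rpredZeq (negPf nz_c).
  (* Zero coordinates of [w] stay zero in the difference, and coordinate [i] becomes zero because
     [theta] fixes 1. *)
  move/min_w; rewrite leqNgt => /negP[]; apply: proper_card.
  apply/properP; split; last first.
    by exists i; rewrite !inE // !mxE -/(u 0 i) mulVf // rmorph1 subrr eqxx.
  apply/subsetP=> j; rewrite !inE; apply: contraNneq => wj0.
  by rewrite !mxE wj0 mulr0 rmorph0 subrr.
have nz_u : u *m B != 0.
  apply: contraTneq isT => u0.
  have := oner_neq0 F; rewrite -ui -[u](mulmxK unitB) u0 mul0mx mxE.
  by rewrite eqxx.
exists <[u *m B]>%VS; split; last by rewrite -memvE.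
  exact: is_point_line.
(* Here the converse half of [sigma_Sigma] is used: a fixed point lies in Sigma. *)
apply/sigma_Sigma; first exact: is_point_line.
apply/eqP; rewrite eq_sym eqEdim collineation_dim leqnn andbT -memvE.
have : f (u *m B) \in sigma <[u *m B]> by rewrite mem_sigma memv_line.
by rewrite fE fix_u rpredZeq (negPf nz_c).
Qed.

End Collineation.

Theorem theorem2p2 (q n : nat) (hq : prime_power q) (hn : (2 <= n)%N)
    (F : finFieldType) (hF : #|F| = (q ^ n)%N)
    (sigma : pg_subspace F n -> pg_subspace F n)
    (hsigma : is_collineation sigma)
    (hfix : forall P : pg_subspace F n,
        is_point P -> (sigma P = P <-> in_Sigma q P))
    (k : nat) (Gamma : pg_subspace F n)
    (hk : pdim Gamma = k%:Z)
    (hdisj : forall P : pg_subspace F n,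
        is_point P -> in_Sigma q P -> ~ (P <= Gamma)%VS)
    (hdim : pdim (Gamma :&: sigma Gamma)%VS = k%:Z - 1) :
  (exists! P : pg_subspace F n,
      is_point P /\ Gamma = orbit_span sigma P k) /\
  (forall P : pg_subspace F n,
      is_point P -> Gamma = orbit_span sigma P k ->
      ~ (iter n.-1 sigma P <= Gamma)%VS).
Proof.
have [theta [f [f_bij mem_sigma]]] := hsigma.
have mono := collineation_mono f_bij mem_sigma.
have dimE := collineation_dim f_bij mem_sigma.
have add := collineation_add f_bij mem_sigma.
have order := collineation_order f_bij mem_sigma hq hn hF hfix.
have pointP P : is_point P <-> \dim P = 1%N.
  rewrite /is_point /pdim; split=> [/eqP|->]; last by rewrite subrr.
  by rewrite subr_eq0 => /eqP[].
have dim_Gamma : \dim Gamma = k.+1.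
  by move/eqP: hk; rewrite /pdim subr_eq -PoszD addn1 => /eqP[].
have dim_cap : \dim (Gamma :&: sigma Gamma) = k.
  by move/addIr: hdim => [].
(* A nonzero stable subspace of [Gamma] would give a point of Sigma in [Gamma]. *)
have free U : (U <= Gamma)%VS -> sigma U = U -> U = 0%VS.
  move=> sUG fixU; apply/eqP; apply: contraT => nz_U.
  have [P [ptP SigmaP sPU]] :=
    collineation_stable f_bij mem_sigma hq hn hF hfix nz_U fixU.
  by case: (hdisj P ptP SigmaP); apply: subv_trans sPU sUG.
split=> [|P _ gP]; last first.
  exact: (orbit_span_last mono dim_Gamma dim_cap (ltnW hn) order gP).
have [P [dimP gP]] :=
  orbit_span_exists mono dimE add free dim_Gamma dim_cap (ltnW hn) order.
exists P; split=> [|Q [/pointP dimQ gQ]]; first by split=> //; apply/pointP.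
exact: (orbit_span_uniq mono dimE free dim_Gamma dim_cap dimP dimQ gP gQ).
Qed.
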